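(* Let $\mathcal{A}$ and $\mathcal{B}$ be generalized Riemann derivatives of orders $m$ and $n$, respectively. Then $\mathcal{B}$ is equivalent to $\mathcal{A}$ if and only if $m=n$ and there are non-zero real constants $A$, $r$ and $s$ such that, for all functions $f:\mathbb{R}\to\mathbb{R}$, all $x\in\mathbb{R}$ and all real $h\neq 0$, $$\frac{\Delta_{\mathcal{B}}f(x,h)}{h^{n}}=\frac{\Delta_{\mathcal{A}}^{\epsilon}f(x,sh)+A\,\Delta_{\mathcal{A}}^{\epsilon'}f(x,rh)}{(sh)^{n}}.$$ (This means that $\Delta_{\mathcal{B}}^{\epsilon}$ is a scaling of $\Delta_{\mathcal{A}}^{\epsilon}$ and $\Delta_{\mathcal{B}}^{\epsilon'}$ is a non-zero scalar multiple of a dilate of $\Delta_{\mathcal{A}}^{\epsilon'}$.) Here $\epsilon=\epsilon(n)$ and $\epsilon'=\epsilon'(n)$.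
   Context: A difference is an expression $\Delta_{\mathcal{A}}f(x,h)=\sum_{i}A_i f(x+a_ih)$ determined by a finite set of real parameters $\mathcal{A}=\{A_1,\ldots,A_p;a_1,\ldots,a_p\}$ with $a_1,\ldots,a_p$ distinct; it is regarded as an operation applied to all functions $f:\mathbb{R}\to\mathbb{R}$. For an integer $n\ge 1$, it is a generalized Riemann difference of order $n$ if the Vandermonde conditions $\sum_i A_i a_i^j=n!\,\delta_{jn}$ hold for $j=0,1,\ldots,n$. The corresponding generalized Riemann derivative of order $n$ (also called the $\mathcal{A}$-derivative, and denoted by $\mathcal{A}$) is $D_{\mathcal{A}}f(x)=\lim_{h\to0}\Delta_{\mathcal{A}}f(x,h)/h^n$; $f$ is $\mathcal{A}$-differentiable at $x$ if this limit exists as a finite number. Two generalized Riemann derivatives $\mathcal{A}$ and $\mathcal{B}$ are equivalent if, for every function $f:\mathbb{R}\to\mathbb{R}$ and every real $x$, $f$ is $\mathcal{A}$-differentiable at $x$ if and only if $f$ is $\mathcal{B}$-differentiable at $x$. The even and odd components of a difference are $\Delta_{\mathcal{A}}^{ev}f(x,h)=\frac{1}{2}\left(\Delta_{\mathcal{A}}f(x,h)+\Delta_{\mathcal{A}}f(x,-h)\right)$ and $\Delta_{\mathcal{A}}^{odd}f(x,h)=\frac{1}{2}\left(\Delta_{\mathcal{A}}f(x,h)-\Delta_{\mathcal{A}}f(x,-h)\right)$. Set $\epsilon(n)=ev$, $\epsilon'(n)=odd$ if $n$ is even, and $\epsilon(n)=odd$, $\epsilon'(n)=ev$ if $n$ is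 odd. For a non-zero real $r$, the $r$-dilate of $\Delta_{\mathcal{A}}f(x,h)$ is $\Delta_{\mathcal{A}}f(x,rh)$. A scaling of an order $n$ generalized Riemann difference $\Delta_{\mathcal{B}}f(x,h)$ is a difference of the form $\Delta_{\mathcal{B}}f(x,sh)/s^n$ with $s\ne0$. *)

(* Defs.v *)
(* The real line is an arbitrary [R : realType] of MathComp-Analysis. *)
From mathcomp Require Import all_boot all_order all_algebra.
From mathcomp Require Import all_classical all_reals all_analysis.

Set Implicit Arguments.
Unset Strict Implicit.
Unset Printing Implicit Defensive.

Import Order.TTheory GRing.Theory Num.Theory.
Import numFieldNormedType.Exports.

Local Open Scope classical_set_scope.
Local Open Scope ring_scope.

(* The coefficients A_i may vanish; only the nodes a_i must be distinct. *)
Record difference (R : realType) := Difference {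
  diff_size : nat;
  coef : 'I_diff_size -> R;
  node : 'I_diff_size -> R;
  node_inj : injective node
}.

Definition diff_app (R : realType) (D : difference R) (f : R -> R) (x h : R) : R :=
  \sum_(i < diff_size D) coef i * f (x + node i * h).

(* For j = 0 the convention 0 ^+ 0 = 1 applies. *)
Definition vandermonde (R : realType) (D : difference R) (n : nat) : Prop :=
  forall j : nat, (j <= n)%N ->
    \sum_(i < diff_size D) coef i * node i ^+ j =
      if j == n then (n`!)%:R else 0.

Definition is_gr_difference (R : realType) (D : difference R) (n : nat) : Prop :=
  (0 < n)%N /\ vandermonde D n.

(* [0^'] is the two-sided punctured neighbourhood filter of 0, and the limit is
   taken in R, hence finite. *)
Definition gr_differentiable (R : realType) (D : difference R) (n : nat)
    (f : R -> R) (x : R) : Prop :=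
  cvg ((fun h : R => diff_app D f x h / h ^+ n) @ (0 : R)^').

(* Each difference comes with the order used to normalise its quotient. *)
Definition gr_equivalent (R : realType) (D : difference R) (m : nat)
    (E : difference R) (n : nat) : Prop :=
  forall (f : R -> R) (x : R),
    gr_differentiable D m f x <-> gr_differentiable E n f x.

Definition diff_even (R : realType) (D : difference R) (f : R -> R) (x h : R) : R :=
  (diff_app D f x h + diff_app D f x (- h)) / 2.

Definition diff_odd (R : realType) (D : difference R) (f : R -> R) (x h : R) : R :=
  (diff_app D f x h - diff_app D f x (- h)) / 2.

(* The component of the same parity as n (epsilon), respectively of the
   opposite parity (epsilon'). *)
Definition diff_eps (R : realType) (n : nat) (D : difference R) :
    (R -> R) -> R -> R -> R :=
  if odd n then diff_odd D else diff_even D.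

Definition diff_eps' (R : realType) (n : nat) (D : difference R) :
    (R -> R) -> R -> R -> R :=
  if odd n then diff_even D else diff_odd D.

(* Main.v *)
Require Import Defs.
From mathcomp Require Import all_boot all_order all_algebra.
From mathcomp Require Import all_classical all_reals all_analysis.
From mathcomp Require Import ring lra.

Set Implicit Arguments.
Unset Strict Implicit.
Unset Printing Implicit Defensive.

Import Order.TTheory GRing.Theory Num.Theory.
Import numFieldNormedType.Exports.
Local Open Scope classical_set_scope.
Local Open Scope ring_scope.

(** The limit as [h] tends to 0 from both sides sees the two parity components
    of a quotient separately ([gr_differentiable_parity]): the component of the
    parity of [n] must converge, the other one must tend to 0.  Both conditions
    are stable under dilations and non-zero factors, which gives the easy
    direction.

    For the converse, fix a parity and the point [x = 0].  A function of that
    parity vanishing at 0 is determined by its values on the positive reals; in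
    the coordinate [ln `|x|] the action of a difference on it becomes a finite
    combination of translates, that is, the action of an element of the group
    algebra of the ordered group [R] ([parity_part_log]).

    The logarithms of the nodes generate a countable group, so there is a negative
    [t] all of whose multiples lie in different cosets of it.  A function that is
    killed by [A] can be rescaled independently on each of these cosets and stays
    killed by [A], hence [A]-differentiable.  If [B] did not kill it as well, the
    rescaling would make the quotient of [B] unbounded along [expR (k%:R * t)],
    which tends to 0 ([kernel_of_differentiability]).  Equivalent derivatives
    therefore have the same kernels.

    The elements that vanish on the kernel of [l] are the multiples of [l], by
    separation of a vector from a subspace ([translation_sum_multiple]).  Equal
    kernels thus mean mutual divisibility.  As the group is ordered, the width of
    the support is additive under products, so the quotient is a single translate
    times a scalar ([mutual_multiples]); back in the original coordinate this is
    a dilation with a non-zero factor ([parity_part_dilate]).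

    Finally, monomials turn these relations into relations between moments.  The
    order is the index of the first non-zero moment, hence [m = n], and equality
    of the [n]-th moments fixes the factor in the parity of [n]. *)

(** * Separating a vector from a subspace *)

Definition linear_subspace (F : fieldType) (V : lmodType F) (W : set V) : Prop :=
  W 0 /\ forall (a : F) (x y : V), W x -> W y -> W (a *: x + y).

Lemma subspaceZ (F : fieldType) (V : lmodType F) (W : set V) (a : F) (x : V) :
  linear_subspace W -> W x -> W (a *: x).
Proof. by move=> [W0 WP] Wx; rewrite -[a *: x]addr0; exact: WP. Qed.

Lemma subspaceB (F : fieldType) (V : lmodType F) (W : set V) (x y : V) :
  linear_subspace W -> W x -> W y -> W (x - y).
Proof. by move=> [_ WP] Wx Wy; rewrite addrC -scaleN1r; exact: WP. Qed.

(** Zorn's lemma: a subspace that is maximal among those that contain [W] but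
    not [v] is a complement of the line through [v]. *)
Lemma maximal_subspace_avoiding (F : fieldType) (V : lmodType F) (W : set V)
    (v : V) : linear_subspace W -> ~ W v ->
  exists M : set V, [/\ linear_subspace M, W `<=` M, ~ M v &
    forall y, exists k, M (y - k *: v)].
Proof.
move=> Wsub Wv.
(* The empty set belongs to [P] because it is the union of the empty chain. *)
pose P (M : set V) := M = set0 \/ [/\ linear_subspace M, W `<=` M & ~ M v].
have [|M [PM Mmax]] := @Zorn_bigcup V P.
  move=> C CP Ctot.
  have [C0|/existsNP[X0 /not_implyP[CX0 X0n]]] :=
    pselect (forall X, C X -> X = set0).
    left; apply/seteqP; split=> // x [X CX Xx].
    by rewrite (C0 _ CX) in Xx.
  right.
  have good X x : C X -> X x -> [/\ linear_subspace X, W `<=` X & ~ X v].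
    by move=> CX Xx; case: (CP _ CX) => // XE; rewrite XE in Xx.
  have [x0 X0x0] : X0 !=set0 by apply/set0P/eqP.
  have [[X00 _] WX0 _] := good _ _ CX0 X0x0.
  split.
  - split; first by exists X0.
    move=> a x y [X CX Xx] [Y CY Yy].
    have [XY|YX] := Ctot _ _ CX CY.
      have [[_ YP] _ _] := good _ _ CY Yy.
      by exists Y => //; apply: YP => //; exact: XY.
    have [[_ XP] _ _] := good _ _ CX Xx.
    by exists X => //; apply: XP => //; exact: YX.
  - by move=> x /WX0 X0x; exists X0.
  - by move=> [X CX Xv]; have [_ _] := good _ _ CX Xv; apply.
have {PM} [M0|[Msub WM Mv]] := PM.
  exfalso; apply: (Mmax W); last by right; split.
  by rewrite M0; split=> // W0; case: (W0 0 Wsub.1).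
exists M; split=> // y.
have [My|My] := pselect (M y); first by exists 0; rewrite scale0r subr0.
(* The span of [M] and [y], which contains [v] by maximality of [M]. *)
pose N : set V := [set z | exists2 m, M m & exists k, z = k *: y + m].
have MN : M `<=` N.
  by move=> z Mz; exists z => //; exists 0; rewrite scale0r add0r.
have [k [m Mm vE]] : exists k, exists2 m, M m & v = k *: y + m.
  apply: contrapT => nv; apply: (Mmax N); first split=> //.
    move=> NM; apply/My/NM; exists 0; first exact: Msub.1.
    by exists 1; rewrite scale1r addr0.
  right; split; last first.
  - by move=> [m Mm [k vE]]; apply: nv; exists k, m.
  - exact: subset_trans MN.
  split; first by apply: MN; exact: Msub.1.
  move=> a _ _ [m1 Mm1 [k1 ->]] [m2 Mm2 [k2 ->]].
  exists (a *: m1 + m2); first exact: Msub.2.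
  by exists (a * k1 + k2); rewrite scalerDr scalerA scalerDl addrACA.
have k0 : k != 0.
  by apply/eqP => k0; apply: Mv; rewrite vE k0 scale0r add0r.
exists k^-1.
rewrite vE scalerDr scalerA mulVf // scale1r opprD addrA subrr add0r -scaleNr.
exact: subspaceZ.
Qed.

Lemma separating_functional (F : fieldType) (V : lmodType F) (W : set V)
    (v : V) : linear_subspace W -> ~ W v ->
  exists phi : V -> F,
    [/\ forall a x y, phi (a *: x + y) = a * phi x + phi y,
        forall x, W x -> phi x = 0 & phi v = 1].
Proof.
move=> Wsub Wv.
have [M [Msub WM Mv Mdec]] := maximal_subspace_avoiding Wsub Wv.
pose phi y := sval (cid (Mdec y)).
have phiP y : M (y - phi y *: v) by rewrite /phi; case: cid.
have phi_eq y k : M (y - k *: v) -> phi y = k.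
  move=> Mk; apply: contrapT => /eqP nk; apply: Mv.
  rewrite -[v](@scalerK _ _ (phi y - k)) ?subr_eq0 //.
  apply: subspaceZ => //.
  have -> : (phi y - k) *: v = (y - k *: v) - (y - phi y *: v).
    by rewrite scalerBl opprB [RHS]addrC addrA addrNK.
  exact: subspaceB.
exists phi; split.
- move=> a x y; apply: phi_eq.
  have -> : a *: x + y - (a * phi x + phi y) *: v =
            a *: (x - phi x *: v) + (y - phi y *: v).
    by rewrite scalerBr scalerA scalerDl opprD addrACA.
  exact: Msub.2.
- by move=> x Wx; apply: phi_eq; rewrite scale0r subr0; exact: WM.
- by apply: phi_eq; rewrite scale1r subrr; exact: Msub.1.
Qed.

(** * Combinations of translates *)

(** A list of pairs (coefficient, shift) stands for an element of the group
    algebra of the additive group [R], acting on functions by translation.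
    Repeated shifts and zero coefficients are harmless, which makes the list
    representation closed under concatenation; [reduced] is the normal form. *)
Definition translation_sum (R : realType) (l : seq (R * R)) (g : R -> R)
    (y : R) : R := \sum_(p <- l) p.1 * g (y + p.2).

Definition reduced (R : realType) (l : seq (R * R)) : Prop :=
  uniq (map snd l) /\ forall p, p \in l -> p.1 != 0.

(** Duality: if [l'] were not a multiple of [l] in the group algebra, a linear
    functional would separate it from the ideal of [l].  The values of such a
    functional on the point evaluations form a function that is killed by [l]
    and not by [l']. *)
Lemma translation_sum_multiple (R : realType) (l l' : seq (R * R)) :
  (forall g, (forall y, translation_sum l g y = 0) ->
     translation_sum l' g 0 = 0) ->
  exists k, forall g y,
    translation_sum l' g y = translation_sum k (translation_sum l g) y.
Proof.
move=> ker_ll'.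
pose V : lmodType R := ((R -> R) -> R^o : Type).
pose W : set V := [set w | exists k, forall g,
  w g = translation_sum k (translation_sum l g) 0].
pose v : V := fun g => translation_sum l' g 0.
suff [k vE] : W v.
  exists k; move=> g y; have := vE (fun z => g (y + z)).
  rewrite /v /translation_sum => vE'.
  under eq_bigr do rewrite -[y + _](congr1 (+%R y) (add0r _)).
  rewrite vE'; apply: eq_bigr => p _; congr (_ * _).
  by apply: eq_bigr => q _; rewrite add0r addrA.
apply: contrapT => Wv.
have Wsub : linear_subspace W.
  split; first by exists [::] => g; rewrite /translation_sum big_nil.
  move=> a w1 w2 /= [k1 E1] [k2 E2].
  exists ([seq (a * p.1, p.2) | p <- k1] ++ k2); move=> g.
  rewrite [LHS]/(a * w1 g + w2 g) E1 E2 /translation_sum big_cat big_map.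
  congr (_ + _); rewrite mulr_sumr; apply: eq_bigr => p _ /=.
  by rewrite mulrA.
have [phi [phi_lin phiW phiv]] := separating_functional Wsub Wv.
pose g u := phi (fun G => G u).
have phi_tr k y : phi (fun G => translation_sum k G y) = translation_sum k g y.
  elim: k => [|p k IHk].
    rewrite /translation_sum big_nil; apply: phiW.
    by exists [::] => G; rewrite /translation_sum !big_nil.
  rewrite {2}/translation_sum big_cons -/(translation_sum k g y) -IHk -phi_lin.
  by congr phi; apply/funext => G; rewrite /translation_sum big_cons.
have lg y : translation_sum l g y = 0.
  rewrite -phi_tr; apply: phiW; exists [:: (1, y)] => G.
  by rewrite [RHS]/translation_sum big_seq1 mul1r add0r.
by move/eqP: (ker_ll' _ lg); rewrite -phi_tr phiv oner_eq0.
Qed.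

Lemma exists_reduced (R : realType) (l : seq (R * R)) :
  exists2 l', reduced l' & translation_sum l' = translation_sum l.
Proof.
pose c u := \sum_(p <- l | p.2 == u) p.1.
pose s := undup (map snd l).
exists [seq (c u, u) | u <- s & c u != 0].
  split.
    by rewrite -map_comp map_id filter_uniq // undup_uniq.
  by move=> p /mapP[u]; rewrite mem_filter => /andP[cu _] ->.
apply/funext => g; apply/funext => y.
rewrite /translation_sum big_map big_filter /=.
rewrite big_mkcond /= (eq_bigr (fun u => c u * g (y + u))); last first.
  by move=> u _; case: eqP => //= ->; rewrite mul0r.
transitivity (\sum_(u <- s) \sum_(p <- l | p.2 == u) p.1 * g (y + p.2)).
  apply: eq_bigr => u _; rewrite mulr_suml.
  by apply: eq_bigr => p /eqP ->.
rewrite (exchange_big_dep predT) //= big_seq_cond [RHS]big_seq_cond.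
apply: eq_bigr => p; rewrite andbT => lp.
rewrite (eq_bigl (pred1 p.2)); last by move=> u; rewrite /= eq_sym.
rewrite -big_filter filter_pred1_uniq ?undup_uniq ?mem_undup ?map_f //.
by rewrite big_seq1.
Qed.

Lemma reduced_snd_inj (R : realType) (l : seq (R * R)) :
  reduced l -> {in l &, injective snd}.
Proof.
move=> [+ _]; elim: l => [//|a l IHl] /= /andP[al ul] p q.
rewrite !inE => /predU1P[->|lp] /predU1P[->|lq] //= pq.
- by move: al; rewrite pq map_f.
- by move: al; rewrite -pq map_f.
- exact: IHl.
Qed.

(** The coefficient of a product at a shift that arises from a single pair of
    shifts is a product of non-zero coefficients, hence does not vanish. *)
Lemma unique_product (R : realType) (k l b : seq (R * R)) (p q : R * R) :
  reduced k -> reduced l ->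
  (forall g y, translation_sum b g y =
     translation_sum k (translation_sum l g) y) ->
  p \in k -> q \in l ->
  (forall p' q' : R * R, p' \in k -> q' \in l -> p'.2 + q'.2 = p.2 + q.2 ->
     p'.2 = p.2 /\ q'.2 = q.2) ->
  p.2 + q.2 \in map snd b.
Proof.
move=> rk rl bE kp lq uniq_pq.
apply: contrapT => /negP nb.
pose g z : R := (z == p.2 + q.2)%:R.
have := bE g 0; rewrite /translation_sum big_seq big1; last first.
  move=> r br; rewrite /g add0r; case: eqP => [rE|]; last by rewrite mulr0.
  by move: nb; rewrite -rE map_f.
rewrite (big_rem p) //= (big_rem q) //= {1}/g add0r eqxx mulr1.
have uniq_of (s : seq (R * R)) : reduced s -> uniq s.
  by move=> [/map_uniq].
rewrite big_seq big1; last first.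
  move=> q' lq'; have {}lq' : q' \in l /\ q' != q.
    by move: lq'; rewrite mem_rem_uniq ?uniq_of // inE => /andP[].
  rewrite /g; case: eqP => [E|]; last by rewrite mulr0.
  have [_ /(reduced_snd_inj rl)] := uniq_pq _ _ kp lq'.1 E.
  by move=> /(_ lq'.1 lq) q'q; case/eqP: lq'.2.
rewrite addr0 big_seq big1 ?addr0; last first.
  move=> p' kp'; have {}kp' : p' \in k /\ p' != p.
    by move: kp'; rewrite mem_rem_uniq ?uniq_of // inE => /andP[].
  rewrite big_seq big1 ?mulr0 // => q' lq'.
  rewrite /g add0r; case: eqP => [E|]; last by rewrite mulr0.
  have [/(reduced_snd_inj rk) + _] := uniq_pq _ _ kp'.1 lq' E.
  by move=> /(_ kp'.1 kp) p'p; case/eqP: kp'.2.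
by move=> /esym/eqP; rewrite mulf_eq0 (negPf (rk.2 _ kp)) (negPf (rl.2 _ lq)).
Qed.

Lemma exists_max_shift (R : realType) (l : seq (R * R)) : l != [::] ->
  exists2 p, p \in l & forall q, q \in l -> q.2 <= p.2.
Proof.
elim: l => [//|a [|b l] IHl _].
  by exists a; rewrite ?mem_head // => q; rewrite inE => /eqP ->.
have [//|p bp pmax] := IHl.
have [pa|ap] := leP p.2 a.2.
  exists a; first exact: mem_head.
  move=> q; rewrite inE => /predU1P[->//|bq].
  exact: le_trans (pmax _ bq) pa.
exists p; first by rewrite inE bp orbT.
move=> q; rewrite inE => /predU1P[->|]; [exact: ltW|exact: pmax].
Qed.

Lemma exists_min_shift (R : realType) (l : seq (R * R)) : l != [::] ->
  exists2 p, p \in l & forall q, q \in l -> p.2 <= q.2.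
Proof.
elim: l => [//|a [|b l] IHl _].
  by exists a; rewrite ?mem_head // => q; rewrite inE => /eqP ->.
have [//|p bp pmin] := IHl.
have [ap|pa] := leP a.2 p.2.
  exists a; first exact: mem_head.
  move=> q; rewrite inE => /predU1P[->//|bq].
  exact: le_trans ap (pmin _ bq).
exists p; first by rewrite inE bp orbT.
move=> q; rewrite inE => /predU1P[->|]; [exact: ltW|exact: pmin].
Qed.

Lemma translation_sum_nil (R : realType) (g : R -> R) (y : R) :
  translation_sum [::] g y = 0.
Proof. by rewrite /translation_sum big_nil. Qed.

Lemma reduced_nonzero (R : realType) (l : seq (R * R)) : reduced l ->
  (forall g y, translation_sum l g y = 0) -> l = [::].
Proof.
move=> rl l0; case: l => [//|p l] in rl l0 *; exfalso.
(* With [l] times the unit of the group algebra as the product, any shift of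
   [l] would have to occur in the empty list. *)
suff : p.2 + ((1, 0) : R * R).2 \in map snd ([::] : seq (R * R)) by [].
apply: (@unique_product R (p :: l) [:: (1, 0)]) => //.
- by split=> // q; rewrite inE => /eqP -> /=; exact: oner_neq0.
- move=> g y; rewrite translation_sum_nil -[LHS](l0 g y).
  apply: eq_bigr => q _.
  by rewrite /translation_sum big_seq1 mul1r addr0.
- exact: mem_head.
- exact: mem_head.
- by move=> p' q' _; rewrite inE => /eqP -> /=; rewrite !addr0.
Qed.

(** The width of a product is the sum of the widths, because its extreme
    shifts arise from a single pair.  Two elements that divide each other
    therefore have the same width, and the quotient has width zero. *)
Lemma mutual_multiples (R : realType) (l l' k k' : seq (R * R)) :
  reduced l -> reduced l' -> reduced k -> reduced k' -> l != [::] ->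
  (forall g y, translation_sum l' g y =
     translation_sum k (translation_sum l g) y) ->
  (forall g y, translation_sum l g y =
     translation_sum k' (translation_sum l' g) y) ->
  exists c u, c != 0 /\ k = [:: (c, u)].
Proof.
move=> rl rl' rk rk' l0 l'E lE.
have l'0 : l' != [::].
  apply: contra_not_neq (elimN eqP l0) => l'0; apply: reduced_nonzero => // g y.
  rewrite lE /translation_sum big1 // => p _.
  by rewrite l'0 big_nil mulr0.
have k0 : k != [::].
  apply: contra_not_neq (elimN eqP l'0) => k0; apply: reduced_nonzero => // g y.
  by rewrite l'E k0 translation_sum_nil.
have k'0 : k' != [::].
  apply: contra_not_neq (elimN eqP l0) => k'0; apply: reduced_nonzero => // g y.
  by rewrite lE k'0 translation_sum_nil.
have [ml lml mlP] := exists_min_shift l0.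
have [Ml lMl MlP] := exists_max_shift l0.
have [ml' lml' ml'P] := exists_min_shift l'0.
have [Ml' lMl' Ml'P] := exists_max_shift l'0.
have [mk kmk mkP] := exists_min_shift k0.
have [Mk kMk MkP] := exists_max_shift k0.
have [mk' kmk' mk'P] := exists_min_shift k'0.
have [Mk' kMk' Mk'P] := exists_max_shift k'0.
have /mapP[x1 /Ml'P X1 E1] : Mk.2 + Ml.2 \in map snd l'.
  apply: (unique_product rk rl l'E kMk lMl) => p q kp lq.
  by have := MkP _ kp; have := MlP _ lq; split; lra.
have /mapP[x2 /ml'P X2 E2] : mk.2 + ml.2 \in map snd l'.
  apply: (unique_product rk rl l'E kmk lml) => p q kp lq.
  by have := mkP _ kp; have := mlP _ lq; split; lra.
have /mapP[x3 /MlP X3 E3] : Mk'.2 + Ml'.2 \in map snd l.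
  apply: (unique_product rk' rl' lE kMk' lMl') => p q kp lq.
  by have := Mk'P _ kp; have := Ml'P _ lq; split; lra.
have /mapP[x4 /mlP X4 E4] : mk'.2 + ml'.2 \in map snd l.
  apply: (unique_product rk' rl' lE kmk' lml') => p q kp lq.
  by have := mk'P _ kp; have := ml'P _ lq; split; lra.
(* Adding up, the widths of [k] and [k'] have a sum that is at most 0. *)
have k'w := mk'P _ kMk'; have kw := mkP _ kMk.
have kE p : p \in k -> p.2 = mk.2.
  by move=> kp; have := mkP _ kp; have := MkP _ kp; lra.
case: k rk kE k0 {l'E mkP MkP kmk kMk} => [//|[c u] k] rk kE _.
exists c, u; split; first by have := rk.2 (c, u); rewrite mem_head; exact.
case: k rk kE => [//|q k] rk kE.
have /= uE := kE (c, u) (mem_head _ _).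
have qE : q.2 = mk.2 by apply: kE; rewrite !inE eqxx orbT.
by have := rk.1; rewrite /= inE uE qE eqxx.
Qed.

(** Kernels determine a combination of translates up to a unit of the group
    algebra, and the units are the multiples of single translations. *)
Lemma translation_sum_kernel_eq (R : realType) (l l' : seq (R * R)) :
  (forall g, (forall y, translation_sum l g y = 0) <->
     (forall y, translation_sum l' g y = 0)) ->
  exists c u, c != 0 /\
    forall g y, translation_sum l' g y = c * translation_sum l g (y + u).
Proof.
move=> ker_eq.
have [k0 E0] : exists k, forall g y,
    translation_sum l' g y = translation_sum k (translation_sum l g) y.
  by apply: translation_sum_multiple => g /ker_eq.
have [k0' E0'] : exists k, forall g y,
    translation_sum l g y = translation_sum k (translation_sum l' g) y.
  by apply: translation_sum_multiple => g /ker_eq.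
have [r rr rE] := exists_reduced l; have [r' rr' rE'] := exists_reduced l'.
have [k rk kE] := exists_reduced k0; have [k' rk' kE'] := exists_reduced k0'.
move: E0 E0'; rewrite -rE -rE' -kE -kE' => E0 E0'.
have [r0|r0] := eqVneq r [::].
  exists 1, 0; split; first exact: oner_neq0.
  move=> g y; rewrite E0 r0 translation_sum_nil mulr0 /translation_sum.
  by apply: big1 => p _; rewrite big_nil mulr0.
have [c [u [c0 kcu]]] := mutual_multiples rr rr' rk rk' r0 E0 E0'.
exists c, u; split=> // g y.
by rewrite E0 kcu /(translation_sum [:: _]) big_seq1.
Qed.

(** * Prescribing values along a geometric progression *)

Definition rational_span (R : realType) (s : seq R) : set R :=
  [set \sum_(i < size s) ratr (q i) * s`_i |
     q in [set: {ffun 'I_(size s) -> rat}]].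

Lemma rational_span_countable (R : realType) (s : seq R) :
  countable (rational_span s).
Proof. exact: sub_countable (card_image_le _ _) (countableP _). Qed.

Lemma rational_span0 (R : realType) (s : seq R) : rational_span s 0.
Proof.
exists [ffun=> 0] => //.
by rewrite big1 // => i _; rewrite ffunE rmorph0 mul0r.
Qed.

Lemma rational_spanD (R : realType) (s : seq R) (x y : R) :
  rational_span s x -> rational_span s y -> rational_span s (x + y).
Proof.
move=> [p _ <-] [q _ <-]; exists [ffun i => p i + q i] => //.
by rewrite -big_split; apply: eq_bigr => i _; rewrite ffunE rmorphD mulrDl.
Qed.

Lemma rational_spanZ (R : realType) (s : seq R) (a : rat) (x : R) :
  rational_span s x -> rational_span s (ratr a * x).
Proof.
move=> [q _ <-]; exists [ffun i => a * q i] => //.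
by rewrite mulr_sumr; apply: eq_bigr => i _; rewrite ffunE rmorphM mulrA.
Qed.

Lemma rational_spanN (R : realType) (s : seq R) (x : R) :
  rational_span s x -> rational_span s (- x).
Proof. by move=> /(rational_spanZ (-1)); rewrite rmorphN1 mulN1r. Qed.

Lemma mem_rational_span (R : realType) (s : seq R) (x : R) :
  x \in s -> rational_span s x.
Proof.
move=> sx; have lt_x : (index x s < size s)%N by rewrite index_mem.
exists [ffun i => (i == Ordinal lt_x)%:R] => //.
rewrite (bigD1 (Ordinal lt_x)) //= ffunE eqxx rmorph1 mul1r nth_index //.
by rewrite big1 ?addr0 // => i /negPf ni; rewrite ffunE ni rmorph0 mul0r.
Qed.

Lemma exists_neg_notin_countable (R : realType) (K : set R) :
  countable K -> exists2 t, t < 0 & ~ K t.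
Proof.
move=> cK; apply: contrapT => nK.
have subK : [set` `]-1, 0[] `<=` K.
  move=> t /=; rewrite in_itv /= => /andP[_ t0].
  by apply: contrapT => Kt; apply: nK; exists t.
have : lebesgue_measure [set` `](-1 : R), 0[] = 0%E.
  apply: countable_lebesgue_measure0.
  exact: sub_countable (subset_card_le subK) cK.
rewrite lebesgue_measure_itv /= lte_fin ltrN10 opprK add0e => /eqP.
by rewrite eqe oner_eq0.
Qed.

(** The rational span [K] of the shifts is countable and closed under division
    by integers, so the multiples of any [t] outside [K] lie in different cosets
    of [K].  Being killed by [l] is a condition on each coset separately: a
    solution [g] can be copied to the coset of every [k%:R * t] and rescaled
    there at will. *)
Lemma kernel_interpolation (R : realType) (l l' : seq (R * R)) :
  exists2 t, t < 0 & forall (g : R -> R) (kappa : nat -> R),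
    (forall y, translation_sum l g y = 0) ->
    exists2 G, forall y, translation_sum l G y = 0 &
      forall k, translation_sum l' G (k%:R * t) =
        kappa k * translation_sum l' g 0.
Proof.
pose K := rational_span (map snd (l ++ l')).
have [t t0 Kt] := exists_neg_notin_countable
  (rational_span_countable (map snd (l ++ l'))).
exists t => // g kappa lg.
have Kl p : p \in l -> K p.2.
  by move=> lp; apply: mem_rational_span; rewrite map_f // mem_cat lp.
have Kl' p : p \in l' -> K p.2.
  by move=> lp; apply: mem_rational_span; rewrite map_f // mem_cat lp orbT.
have K_free (j k : nat) : K (j%:R * t - k%:R * t) -> j = k.
  rewrite -mulrBl => Kjk; apply: contrapT => /eqP njk; apply: Kt.
  have jk0 : j%:R - k%:R != 0 :> R by rewrite subr_eq0 eqr_nat.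
  rewrite -[t](mulKf jk0).
  have -> : (j%:R - k%:R)^-1 = ratr (j%:R - k%:R)^-1 :> R.
    by rewrite fmorphV rmorphB !rmorph_nat.
  exact: rational_spanZ.
pose coset y := [set k : nat | K (y - k%:R * t)].
(* The [k] such that [y] lies in the coset of [k%:R * t]; the default value is
   taken on whole cosets, so [idx] is invariant under [K] everywhere. *)
pose idx y := xget 0%N (coset y).
have idxD y a : K a -> idx (y + a) = idx y.
  move=> Ka; congr xget; apply/seteqP; rewrite /coset; split=> k /= Kk.
    have -> : y - k%:R * t = y + a - k%:R * t + - a by ring.
    by apply: rational_spanD => //; exact: rational_spanN.
  have -> : y + a - k%:R * t = y - k%:R * t + a by ring.
  exact: rational_spanD.
have idx_t k : idx (k%:R * t) = k.
  have : coset (k%:R * t) (idx (k%:R * t)).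
    apply: xgetPex; exists k; rewrite /coset /= subrr.
    exact: rational_span0.
  by move=> /K_free <-.
pose G y := kappa (idx y) * g (y - (idx y)%:R * t).
have GE s y : (forall p, p \in s -> K p.2) ->
    translation_sum s G y =
    kappa (idx y) * translation_sum s g (y - (idx y)%:R * t).
  move=> Ks; rewrite /translation_sum mulr_sumr big_seq [RHS]big_seq.
  apply: eq_bigr => p sp; rewrite /G idxD; last exact: Ks.
  by rewrite mulrCA addrAC.
exists G => [y|k]; first by rewrite GE // lg mulr0.
by rewrite GE // idx_t subrr.
Qed.

(** * Parity components in logarithmic coordinates *)

Definition parity_part (R : realType) (e : nat) (D : difference R)
    (f : R -> R) (x h : R) : R :=
  (diff_app D f x h + (-1) ^+ e * diff_app D f x (- h)) / 2.

Lemma diff_epsE (R : realType) (n : nat) (D : difference R) :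
  diff_eps n D = parity_part n D.
Proof.
apply/funext => f; apply/funext => x; apply/funext => h.
rewrite /diff_eps /parity_part -signr_odd.
by case: (odd n); rewrite ?expr1 ?expr0 ?mulN1r ?mul1r.
Qed.

Lemma diff_eps'E (R : realType) (n : nat) (D : difference R) :
  diff_eps' n D = parity_part n.+1 D.
Proof.
apply/funext => f; apply/funext => x; apply/funext => h.
rewrite /diff_eps' /parity_part -signr_odd /=.
by case: (odd n); rewrite ?expr1 ?expr0 ?mulN1r ?mul1r.
Qed.

Lemma parity_partD (R : realType) (e : nat) (D : difference R)
    (f : R -> R) (x h : R) :
  parity_part e D f x h + parity_part e.+1 D f x h = diff_app D f x h.
Proof. by rewrite /parity_part exprS mulN1r; field. Qed.

Lemma parity_partN (R : realType) (e : nat) (D : difference R)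
    (f : R -> R) (x h : R) :
  parity_part e D f x (- h) = (-1) ^+ e * parity_part e D f x h.
Proof.
rewrite /parity_part opprK mulrA; congr (_ / 2).
by rewrite mulrDr mulrA -expr2 sqrr_sign mul1r addrC.
Qed.

(** The function of parity [e] that vanishes at 0 and is [g] in the coordinate
    [ln `|x|] on the positive reals.  For [0 < e] the convention [sg 0 = 0]
    provides the value at 0. *)
Definition log_extension (R : realType) (e : nat) (g : R -> R) (x : R) : R :=
  Num.sg x ^+ e * g (ln `|x|).

(** For [0 < e] a node at 0 receives the coefficient 0, in accordance with the
    value of [log_extension] there; its logarithm is a dummy value. *)
Definition log_shifts (R : realType) (e : nat) (D : difference R) :
    seq (R * R) :=
  [seq (coef i * Num.sg (node i) ^+ e, ln `|node i|)
     | i <- enum 'I_(diff_size D)].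

Lemma diff_app_log_extension (R : realType) (e : nat) (D : difference R)
    (g : R -> R) (h : R) : (0 < e)%N -> h != 0 ->
  diff_app D (log_extension e g) 0 h =
  Num.sg h ^+ e * translation_sum (log_shifts e D) g (ln `|h|).
Proof.
move=> e0 h0; rewrite /translation_sum big_map big_enum mulr_sumr.
apply: eq_bigr => i _; rewrite add0r /log_extension /=.
have [->|a0] := eqVneq (node i) 0.
  by rewrite mul0r sgr0 expr0n gtn_eqF // !mulr0n !mulr0 !mul0r !mulr0.
rewrite normrM lnM ?posrE ?normr_gt0 // sgrM exprMn.
by rewrite [ln `|h| + _]addrC; ring.
Qed.

(** If the coefficients sum to 0, the constant [f x] can be subtracted; then the
    parity component is the difference of a function of the form
    [log_extension]. *)
Lemma parity_part_log (R : realType) (e : nat) (f : R -> R) (x : R) :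
  (0 < e)%N ->
  exists g, forall D : difference R, \sum_(i < diff_size D) coef i = 0 ->
    forall h, h != 0 ->
      parity_part e D f x h =
      Num.sg h ^+ e * translation_sum (log_shifts e D) g (ln `|h|).
Proof.
move=> e0.
pose F z := ((f (x + z) - f x) + (-1) ^+ e * (f (x - z) - f x)) / 2.
exists (F \o expR) => D sum0 h h0; rewrite -diff_app_log_extension //.
have subE k : diff_app D f x k =
    \sum_(i < diff_size D) coef i * (f (x + node i * k) - f x).
  under eq_bigr do rewrite mulrBr.
  by rewrite big_split /= sumrN -mulr_suml sum0 mul0r subr0.
have FE z : log_extension e (F \o expR) z = F z.
  rewrite /log_extension /=; have [z0|z0|->] := ltrgtP z 0.
  - rewrite ltr0_sg // ltr0_norm // lnK ?posrE ?oppr_gt0 // /F opprK mulrA.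
    by congr (_ / 2); rewrite mulrDr mulrA -expr2 sqrr_sign mul1r addrC.
  - by rewrite gtr0_sg // expr1n mul1r gtr0_norm // lnK.
  - rewrite sgr0 expr0n gtn_eqF // mulr0n mul0r /F addr0 subr0 subrr.
    by rewrite mulr0 addr0 mul0r.
rewrite /parity_part !subE mulr_sumr -big_split mulr_suml.
apply: eq_bigr => i _; rewrite FE add0r /F mulrN /=; ring.
Qed.

Lemma parity_part_monomial (R : realType) (j : nat) (D : difference R) (h : R) :
  parity_part j D (fun y => y ^+ j) 0 h =
    h ^+ j * \sum_(i < diff_size D) coef i * node i ^+ j.
Proof.
rewrite /parity_part /diff_app !mulr_sumr -big_split mulr_suml.
apply: eq_bigr => i _ /=; rewrite !add0r mulrN -[- (_ * h)]mulN1r.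
rewrite [(-1 * (_ * h)) ^+ j]exprMn.
by rewrite [(-1) ^+ j * _]mulrCA signrMK exprMn; field.
Qed.

(** * Differentiability and kernels *)

Lemma cvg_dnbhs0 (R : realType) (T : Type) (F : set_system T)
    (FF : Filter F) (u : T -> R) :
  u @ F --> (0 : R) -> (\forall k \near F, u k != 0) -> u @ F --> (0 : R)^'.
Proof.
move=> u0 un0 P P0.
have {P0} P0 : nbhs (0 : R) [set x | x != 0 -> P x] by exact: P0.
have {}u0 : \forall k \near F, u k != 0 -> P (u k) by exact: u0 P0.
by apply: filterS2 u0 un0 => k /[apply].
Qed.

Lemma expR_mul_cvg_dnbhs (R : realType) (t : R) : t < 0 ->
  (fun k : nat => expR (k%:R * t)) @ \oo --> (0 : R)^'.
Proof.
move=> t0; apply: cvg_dnbhs0.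
  rewrite (_ : (fun k : nat => _) = GRing.exp (expR t)).
    by apply: cvg_expr; rewrite ger0_norm ?expR_ge0 // -expR0 ltr_expR.
  by apply/funext => k; rewrite expRM_natl.
by apply: nearW => k; rewrite lt0r_neq0 ?expR_gt0.
Qed.

(** If [B] did not see a solution of [A] as a solution, interpolation would
    produce a function that [A] kills while the quotients of [B] are unbounded
    along a sequence tending to 0. *)
Lemma kernel_of_differentiability (R : realType) (A B : difference R)
    (m n e : nat) (g : R -> R) : (0 < e)%N ->
  (forall f, gr_differentiable A m f 0 -> gr_differentiable B n f 0) ->
  (forall y, translation_sum (log_shifts e A) g y = 0) ->
  forall y, translation_sum (log_shifts e B) g y = 0.
Proof.
move=> e0 AB Ag y; apply: contrapT => /eqP By.
have shiftE l z : translation_sum l (fun u => g (y + u)) z =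
    translation_sum l g (y + z).
  by apply: eq_bigr => p _; rewrite addrA.
have [t t0 interp] := kernel_interpolation (log_shifts e A) (log_shifts e B).
(* The factor [k%:R] survives the division by [h ^+ n] at
   [h = expR (k%:R * t)] and makes the quotients unbounded. *)
have {interp} [|G AG BG] := interp (fun u => g (y + u))
  (fun k => k%:R * expR (k%:R * t) ^+ n).
  by move=> z; rewrite shiftE.
rewrite shiftE addr0 in BG; set b := translation_sum _ _ _ in By BG.
have /AB /cvg_ex[L /= BL] : gr_differentiable A m (log_extension e G) 0.
  apply/cvg_ex; exists 0; apply: cvg_near_cst.
  near=> h.
  have h0 : h != 0 by near: h; exact: nbhs_dnbhs_neq.
  by rewrite diff_app_log_extension // AG mulr0 mul0r.
have Bk k : diff_app B (log_extension e G) 0 (expR (k%:R * t)) /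
    expR (k%:R * t) ^+ n = k%:R * b.
  have E0 := expR_gt0 (k%:R * t).
  rewrite diff_app_log_extension ?lt0r_neq0 // gtr0_sg // expr1n mul1r.
  rewrite gtr0_norm // expRK BG mulrAC mulfK // expf_neq0 //.
  exact: lt0r_neq0.
have := cvg_comp _ _ (expR_mul_cvg_dnbhs t0) BL.
move=> /cvgP /cvg_seq_bounded [M [_ Mb]].
have /Mb {}Mb : M < `|M| + 1 by rewrite ltr_pwDr // ler_norm.
have b0 : 0 < `|b| by rewrite normr_gt0.
have := Mb (Num.truncn ((`|M| + 1) / `|b|)).+1 I.
rewrite /= Bk normrM ger0_norm // -ler_pdivlMr // leNgt.
by rewrite Num.Theory.truncnS_gt.
Unshelve. all: by end_near. Qed.

Lemma vandermonde_sum0 (R : realType) (D : difference R) (n : nat) :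
  is_gr_difference D n -> \sum_(i < diff_size D) coef i = 0.
Proof.
move=> [n0 /(_ 0 isT)]; rewrite ltn_eqF // => sum0.
by rewrite -[RHS]sum0; apply: eq_bigr => i _; rewrite expr0 mulr1.
Qed.

(** Equality of the kernels in logarithmic coordinates, where multiplying [h]
    by a positive number is a translation. *)
Lemma parity_part_dilate (R : realType) (A B : difference R) (m n e : nat) :
  is_gr_difference A m -> is_gr_difference B n -> gr_equivalent B n A m ->
  (0 < e)%N ->
  exists c s : R, [/\ c != 0, 0 < s & forall f x h, h != 0 ->
    parity_part e B f x h = c * parity_part e A f x (s * h)].
Proof.
move=> hA hB eqBA e0.
have [|c [u [c0 BA]]] :=
  @translation_sum_kernel_eq R (log_shifts e A) (log_shifts e B).
  move=> g; split.
    exact: (kernel_of_differentiability e0 (fun f => (eqBA f 0).2)).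
  exact: (kernel_of_differentiability e0 (fun f => (eqBA f 0).1)).
exists c, (expR u); split=> // [|f x h h0]; first exact: expR_gt0.
have u0 : expR u != 0 by exact: lt0r_neq0 (expR_gt0 _).
have [g fg] := parity_part_log f x e0.
rewrite !fg ?mulf_neq0 //; [|exact: vandermonde_sum0 hA|exact: vandermonde_sum0 hB].
rewrite BA sgrM (gtr0_sg (expR_gt0 u)) mul1r normrM gtr0_norm ?expR_gt0 //.
by rewrite lnM ?posrE ?expR_gt0 ?normr_gt0 // expRK [u + _]addrC; ring.
Qed.

(** * Separating the parities in the limit *)

Lemma dilation_cvg_dnbhs (R : realType) (s : R) : s != 0 ->
  (fun h : R => s * h) @ (0 : R)^' --> (0 : R)^'.
Proof.
move=> s0; apply: cvg_dnbhs0.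
  rewrite -[X in _ --> X](mulr0 s); apply: cvgMl_tmp; exact: cvg_within.
by near=> h; rewrite mulf_neq0 //; near: h; exact: nbhs_dnbhs_neq.
Unshelve. all: by end_near. Qed.

Lemma cvg_dilate (R : realType) (q q' : R -> R) (L c s : R) : s != 0 ->
  (forall h, h != 0 -> q' h = c * q (s * h)) ->
  q @ (0 : R)^' --> L -> q' @ (0 : R)^' --> c * L.
Proof.
move=> s0 qE qL.
apply: cvg_trans (cvgMl_tmp (cvg_comp _ _ (dilation_cvg_dnbhs s0) qL)).
apply: near_eq_cvg; near=> h; rewrite qE //.
by near: h; exact: nbhs_dnbhs_neq.
Unshelve. all: by end_near. Qed.

(** Replacing [h] by [- h] in the limit separates the parity components of the
    quotient; the odd one can only tend to 0. *)
Lemma gr_differentiable_parity (R : realType) (D : difference R) (n : nat)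
    (f : R -> R) (x : R) :
  gr_differentiable D n f x <->
  cvg ((fun h => parity_part n D f x h / h ^+ n) @ (0 : R)^') /\
  ((fun h => parity_part n.+1 D f x h / h ^+ n) @ (0 : R)^' --> (0 : R)).
Proof.
split=> [/cvg_ex[L /= qL]|[/cvg_ex[L /= pL] p'0]]; last first.
  apply/cvg_ex; exists (L + 0).
  rewrite (_ : (fun h => _) = (fun h => parity_part n D f x h / h ^+ n) \+
      (fun h => parity_part n.+1 D f x h / h ^+ n)); first exact: cvgD.
  by apply/funext => h /=; rewrite -mulrDl parity_partD.
have qNL : (fun h => (-1) ^+ n * diff_app D f x (- h) / h ^+ n) @ (0 : R)^' --> L.
  have N10 : (-1 : R) != 0 by rewrite oppr_eq0 oner_eq0.
  rewrite -[L]mul1r; apply: (cvg_dilate N10 _ qL) => h _.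
  by rewrite mulN1r [(- h) ^+ n]exprNn invfM invr_sign mul1r mulrCA mulrA.
split.
  apply/cvg_ex; exists ((L + L) / 2).
  rewrite (_ : (fun h => _) = (fun h => (diff_app D f x h / h ^+ n +
      (-1) ^+ n * diff_app D f x (- h) / h ^+ n) / 2)).
    by apply: cvgMr_tmp; exact: cvgD.
  by apply/funext => h; rewrite /parity_part -mulrDl mulrAC.
have L0 : (L - L) / 2 = 0 by rewrite subrr mul0r.
rewrite -[X in _ --> X]L0 (_ : (fun h => _) = (fun h => (diff_app D f x h / h ^+ n -
    (-1) ^+ n * diff_app D f x (- h) / h ^+ n) / 2)).
  by apply: cvgMr_tmp; exact: cvgB.
by apply/funext => h; rewrite /parity_part -mulrBl mulrAC exprS mulN1r mulNr.
Qed.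

Lemma gr_differentiable_dilate (R : realType) (A B : difference R) (n : nat)
    (f : R -> R) (x c c' s r : R) : s != 0 -> r != 0 ->
  (forall h, h != 0 ->
     parity_part n B f x h = c * parity_part n A f x (s * h)) ->
  (forall h, h != 0 ->
     parity_part n.+1 B f x h = c' * parity_part n.+1 A f x (r * h)) ->
  gr_differentiable A n f x -> gr_differentiable B n f x.
Proof.
move=> s0 r0 BA BA' /gr_differentiable_parity[/cvg_ex[L /= pL] p'0].
apply/gr_differentiable_parity; split.
  apply/cvg_ex; exists (c * s ^+ n * L); apply: (cvg_dilate s0 _ pL) => h h0.
  by rewrite BA // exprMn; field; rewrite !expf_neq0.
rewrite -[X in _ --> X](mulr0 (c' * r ^+ n)).
apply: (cvg_dilate r0 _ p'0) => h h0.
by rewrite BA' // exprMn; field; rewrite !expf_neq0.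
Qed.

(** * The classification *)

(** A dilation multiplies the [j]-th moment by a non-zero number, and the order
    is the index of the first non-zero moment. *)
Lemma moment_dilate (R : realType) (A B : difference R) (m n j : nat) :
  is_gr_difference A m -> is_gr_difference B n -> gr_equivalent B n A m ->
  (0 < j)%N ->
  exists2 a, a != 0 & \sum_(i < diff_size B) coef i * node i ^+ j =
    a * \sum_(i < diff_size A) coef i * node i ^+ j.
Proof.
move=> hA hB eqBA j0.
have [c [s [c0 s0 BA]]] := parity_part_dilate hA hB eqBA j0.
exists (c * s ^+ j); first by rewrite mulf_neq0 // expf_neq0 // lt0r_neq0.
have := BA (fun y => y ^+ j) 0 1 (oner_neq0 _).
by rewrite !parity_part_monomial mulr1 expr1n mul1r mulrA.
Qed.

Lemma gr_equivalent_order_le (R : realType) (A B : difference R) (m n : nat) :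
  is_gr_difference A m -> is_gr_difference B n -> gr_equivalent B n A m ->
  (m <= n)%N.
Proof.
move=> hA hB eqBA; rewrite leqNgt; apply/negP => nm.
have [a _] := moment_dilate hA hB eqBA hB.1.
rewrite hB.2 // hA.2 ?(ltnW nm) // (ltn_eqF nm) eqxx mulr0 => /eqP.
by rewrite pnatr_eq0 eqn0Ngt fact_gt0.
Qed.

Theorem theorem2 (R : realType) (m n : nat) (A B : difference R)
    (hA : is_gr_difference A m) (hB : is_gr_difference B n) :
  gr_equivalent B n A m <->
  (m = n /\
   exists c r s : R, [/\ c != 0, r != 0, s != 0 &
     forall (f : R -> R) (x h : R), h != 0 ->
       diff_app B f x h / h ^+ n =
       (diff_eps n A f x (s * h) + c * diff_eps' n A f x (r * h))
         / (s * h) ^+ n]).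
Proof.
rewrite diff_epsE diff_eps'E; split=> [eqBA|[mn]].
  have mn : m = n.
    apply/eqP; rewrite eqn_leq (gr_equivalent_order_le hA hB eqBA) /=.
    by apply: (gr_equivalent_order_le hB hA) => f x; exact: iff_sym (eqBA f x).
  subst m; split=> //.
  have [c1 [s [c10 s0 BA]]] := parity_part_dilate hA hB eqBA hB.1.
  have [c2 [r [c20 r0 BA']]] := parity_part_dilate hA hB eqBA (ltn0Sn n).
  (* Both [n]-th moments are [n`!], which determines [c1]. *)
  have cs1 : c1 * s ^+ n = 1.
    have := BA (fun y => y ^+ n) 0 1 (oner_neq0 _).
    rewrite !parity_part_monomial mulr1 expr1n mul1r hA.2 // hB.2 // eqxx mulrA.
    move=> /esym; rewrite -[X in _ = X]mul1r; apply: mulIf.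
    by rewrite pnatr_eq0 eqn0Ngt fact_gt0.
  have sn0 : s ^+ n != 0 by rewrite expf_neq0 ?lt0r_neq0.
  exists (c2 * s ^+ n), r, s; split; [exact: mulf_neq0|exact: lt0r_neq0 r0|
    exact: lt0r_neq0 s0|].
  move=> f x h h0; have hn0 : h ^+ n != 0 by rewrite expf_neq0.
  rewrite -(parity_partD n) BA // BA' // exprMn.
  have -> : c1 = (s ^+ n)^-1 by rewrite -[LHS](mulfK sn0) cs1 mul1r.
  by field; rewrite hn0 sn0.
subst m => -[c [r [s [c0 r0 s0 BA]]]].
have sn0 : s ^+ n != 0 by rewrite expf_neq0.
have {}BA f x h : h != 0 -> diff_app B f x h =
    (s ^+ n)^-1 * (parity_part n A f x (s * h) +
      c * parity_part n.+1 A f x (r * h)).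
  move=> h0; have hn0 : h ^+ n != 0 by rewrite expf_neq0.
  rewrite -[LHS](divfK hn0) BA // exprMn; field; by rewrite hn0 sn0.
have BA1 f x h : h != 0 -> parity_part n B f x h =
    (s ^+ n)^-1 * parity_part n A f x (s * h).
  move=> h0; rewrite {1}/parity_part !BA ?oppr_eq0 // !mulrN !parity_partN.
  rewrite exprS mulN1r; set a := (s ^+ n)^-1; set u := (-1) ^+ n.
  set X := parity_part n A f x _; set Y := parity_part n.+1 A f x _.
  have uu : u * u = 1 by rewrite -expr2 sqrr_sign.
  transitivity (a * ((1 + u * u) * X + (1 - u * u) * (c * Y)) / 2); first ring.
  by rewrite uu; field.
have BA2 f x h : h != 0 -> parity_part n.+1 B f x h =
    (s ^+ n)^-1 * c * parity_part n.+1 A f x (r * h).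
  move=> h0.
  have := parity_partD n B f x h; rewrite BA // BA1 // => /(canRL (addKr _)) ->.
  ring.
move=> f x; split.
  apply: (@gr_differentiable_dilate R B A n f x (s ^+ n)
    (s ^+ n / c) s^-1 r^-1); rewrite ?invr_eq0 // => h h0.
    by rewrite BA1 ?mulf_neq0 ?invr_eq0 // mulVKf // mulVKf.
  rewrite BA2 ?mulf_neq0 ?invr_eq0 // mulVKf //; field; by rewrite c0 sn0.
exact: (gr_differentiable_dilate s0 r0 (BA1 f x) (BA2 f x)).
Qed.
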